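(* Let $(A_r)_{r\ge 0}$ be a sequence of diagram algebras over an integral domain $R$ with field of fractions $\mathbb{F}$ (see context), and assume that it has an additive or multiplicative family of Jucys–Murphy elements $\{L_i : i\ge1\}$. Then the Jucys–Murphy elements act diagonally on the seminormal bases. More precisely, there exist scalars $\kappa_{\mu\to\lambda}\in R$ associated to the edges $\mu\to\lambda$ of $\widehat A$ such that for all $r$, all $\lambda\in\widehat A_r$, all $\mathsf t\in\mathrm{Std}_r(\lambda)$ and all $1\le i\le r$, $$f^\lambda_{\mathsf t}L_i=\kappa_{\mathsf t(i-1)\to\mathsf t(i)}\,f^\lambda_{\mathsf t}.$$
   Context: **Cellular algebras.** A cellular algebra over $R$ is a unital $R$-algebra $A$ with an algebra involution $*$ ($R$-linear anti-automorphism, $(x^* )^*=x$), a finite poset $(\widehat A,\trianglerighteq)$, a finite index set $T(\lambda)$ for each $\lambda\in\widehat A$, and an $R$-basis $\{c^\lambda_{st}:\lambda\in\widehat A,\ s,t\in T(\lambda)\}$ such that, with $A^{\triangleright\lambda}$ (resp. $A^{\trianglerighteq\lambda}$) the span of the $c^\mu_{st}$ with $\mu\triangleright\lambda$ (resp. $\mu\trianglerighteq\lambda$): (a) for $t\in T(\lambda)$, $a\in A$ there are $r(a;t,v)\in R$ with $c^\lambda_{st}a\equiv\sum_v r(a;t,v)c^\lambda_{sv}$ mod $A^{\triangleright\lambda}$ for all $s$; (b) $(c^\lambda_{st})^*\equiv c^\lambda_{ts}$ mod $A^{\triangleright\lambda}$. The cell module $\Delta(\lambda)$ is the right $A$-module,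 free over $R$ on $\{c^\lambda_t\}$, with $c^\lambda_t a=\sum_v r(a;t,v)c^\lambda_v$. There is an $A$-$A$-bimodule isomorphism $\alpha_\lambda:A^{\trianglerighteq\lambda}/A^{\triangleright\lambda}\to\Delta(\lambda)^*\otimes_R\Delta(\lambda)$, $c^\lambda_{st}+A^{\triangleright\lambda}\mapsto (c^\lambda_s)^*\otimes c^\lambda_t$, where $M^*$ is the left module obtained from a right module $M$ via $*$. $A$ is cyclic cellular if every cell module is cyclic. A cell filtration of a right module is a finite filtration $0=M_0\subseteq\dots\subseteq M_p$ with $M_i/M_{i-1}\cong\Delta(\lambda^{(i)})$; it is order preserving if $\lambda^{(i)}\triangleright\lambda^{(i+1)}$ for all $i$. **Sequence of diagram algebras.** $(A_r)_{r\ge0}$ is an increasing sequence of cellular algebras over $R$, with unital inclusions and compatible involutions; $\widehat A_r$ is the poset of $A_r$, $\Delta_r(\lambda)$ its cell modules, $A_r^{\mathbb F}=A_r\otimes_R\mathbb F$, $\Delta_r^{\mathbb F}(\lambda)=\Delta_r(\lambda)\otimes_R\mathbb F$. For each $\lambda\in\widehat A_r$ a generator $\delta_r(\lambda)$ of $\Delta_r(\lambda)$ and an element $m_\lambda\in A_r^{\trianglerighteq\lambda}$ with $\alpha_\lambda(m_\lambda+A_r^{\triangleright\lambda})=\delta_r(\lambda)^*\otimes\delta_r(\lambda)$ are fixed; $\Delta_r(\lambda)$ is identified with $(m_\lambda A_r+A_r^{\triangleright\lambda})/A_r^{\triangleright\lambda}$ via $\delta_r(\lambda)a\leftrightarrow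 m_\lambda a+A_r^{\triangleright\lambda}$. Axioms: (D1) $A_0=R$ ($\widehat A_0=\{\varnothing\}$, $\Delta_0(\varnothing)=R$, $m_\varnothing=1$); (D2) each $A_r$ is cyclic cellular; (D3) $m_\lambda=m_\lambda^*$; (D4) each $A_r^{\mathbb F}$ is split semisimple; (D5) (restriction coherence) for each $\mu\in\widehat A_{r+1}$ the restriction of $\Delta_{r+1}(\mu)$ to $A_r$ has an order preserving cell filtration; (D6) below. **Branching diagram, branching factors.** $\widehat A$ is the graded directed graph with vertex set $\widehat A_r$ at level $r$ and an edge $\lambda\to\mu$ ($\lambda\in\widehat A_{r-1}$, $\mu\in\widehat A_r$) iff $\Delta_{r-1}(\lambda)$ is a subquotient in the order preserving cell filtration of the restriction of $\Delta_r(\mu)$ to $A_{r-1}$. Fixing such a filtration $(M_j)$ with isomorphisms $M_j/M_{j-1}\cong\Delta_{r-1}(\lambda_j)$, the branching factor $d_{\lambda_j\to\mu}\in A_r$ is a chosen element with $\delta_r(\mu)d_{\lambda_j\to\mu}\in M_j$ whose class in $M_j/M_{j-1}$ corresponds to $\delta_{r-1}(\lambda_j)$. (D6): there are elements $u_{\mu\to\lambda}\in A_{r+1}$ for each edge $\mu\to\lambda$ ($\mu\in\widehat A_r,\lambda\in\widehat A_{r+1}$) with $m_\lambda d_{\mu\to\lambda}=(u_{\mu\to\lambda})^*m_\mu$. **Paths, Murphy basis.** $\mathrm{Std}_r(\nu)$ is the set of directed paths $\mathsf t=(\varnothing=\mathsf t(0)\to\mathsf t(1)\to\dots\to\mathsf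 t(r)=\nu)$, and $\mathrm{Std}_r=\bigcup_\nu\mathrm{Std}_r(\nu)$. For such $\mathsf t$, $d_{\mathsf t}=d_{\mathsf t(r-1)\to\mathsf t(r)}\cdots d_{\mathsf t(0)\to\mathsf t(1)}$. The Murphy basis $m^\nu_{\mathsf t}=m_\nu d_{\mathsf t}+A_r^{\triangleright\nu}$, $\mathsf t\in\mathrm{Std}_r(\nu)$, is known to be an $R$-basis of $\Delta_r(\nu)$. **Seminormal basis.** For $\lambda\in\widehat A_s$ let $z_s^\lambda$ be the minimal central idempotent of $A_s^{\mathbb F}$ corresponding to the simple module $\Delta_s^{\mathbb F}(\lambda)$. For $\mathsf t\in\mathrm{Std}_r$, $F_{\mathsf t}=\prod_{s=1}^r z_s^{\mathsf t(s)}$. The seminormal basis of $\Delta_r^{\mathbb F}(\lambda)$ is $f^\lambda_{\mathsf t}=m^\lambda_{\mathsf t}F_{\mathsf t}$, $\mathsf t\in\mathrm{Std}_r(\lambda)$. **Jucys–Murphy elements.** $\{L_r:r\ge1\}$ is an additive family of Jucys–Murphy elements if (1) for all $r\ge1$, $L_r\in A_r$, $L_r^*=L_r$, and $L_r$ commutes with $A_{r-1}$; (2) for all $r\ge1$ and $\lambda\in\widehat A_r$ there is $d(\lambda)\in R$ such that $L_1+\dots+L_r$ acts as the scalar $d(\lambda)$ on $\Delta_r(\lambda)$; and $d(\varnothing)=0$ for $\varnothing\in\widehat A_0$. It is a multiplicative family if (1) for all $r\ge1$, $L_r$ is an invertible element of $A_r$, $L_r^*=L_r$, and $L_r$ commutes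 with $A_{r-1}$; (2) for all $r\ge1$ and $\lambda\in\widehat A_r$ there is $d(\lambda)\in R$ such that $L_1\cdots L_r$ acts as the scalar $d(\lambda)$ on $\Delta_r(\lambda)$; and $d(\varnothing)=1$. *)

(* Defs.v *)
From HB Require Import structures.
From mathcomp Require Import all_boot all_order all_algebra.

Set Implicit Arguments.
Unset Strict Implicit.
Unset Printing Implicit Defensive.

Import Order.TTheory GRing.Theory.
Local Open Scope ring_scope.

Section ScalarExtension.
Variables (R : comNzRingType) (I : finType).

Definition is_basis (V : lmodType R) (e : I -> V) : Prop :=
  forall v : V, exists! x : {ffun I -> R}, v = \sum_i x i *: e i.

Fact coord_ex (V : lmodType R) (e : I -> V) (be : is_basis e) (v : V) :
  exists x : {ffun I -> R}, v == \sum_i x i *: e i.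
Proof. by have [x [/eqP vE _]] := be v; exists x. Qed.

Definition coord (V : lmodType R) (e : I -> V) (be : is_basis e) (v : V) :
  {ffun I -> R} := xchoose (coord_ex be v).

Lemma coordE (V : lmodType R) (e : I -> V) (be : is_basis e) (v : V) :
  v = \sum_i coord be v i *: e i.
Proof. exact/eqP/(xchooseP (coord_ex be v)). Qed.

Lemma coord_uniq (V : lmodType R) (e : I -> V) (be : is_basis e) (v : V)
    (x : {ffun I -> R}) :
  v = \sum_i x i *: e i -> coord be v = x.
Proof.
move=> vE; have [y [_ yP]] := be v.
by rewrite -(yP _ vE); apply/esym/yP; exact: coordE.
Qed.

Lemma coordD (V : lmodType R) (e : I -> V) (be : is_basis e) u v :
  coord be (u + v) = coord be u + coord be v.
Proof.
apply: coord_uniq; rewrite {1}(coordE be u) {1}(coordE be v) -big_split /=.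
by apply: eq_bigr => i _; rewrite ffunE scalerDl.
Qed.

Lemma coordZ (V : lmodType R) (e : I -> V) (be : is_basis e) a v i :
  coord be (a *: v) i = a * coord be v i.
Proof.
rewrite (@coord_uniq _ _ be (a *: v) [ffun i => a * coord be v i]) ?ffunE //.
rewrite {1}(coordE be v) scaler_sumr.
by apply: eq_bigr => j _; rewrite ffunE scalerA.
Qed.

Variables (S : comNzRingType) (phi : {rmorphism R -> S}).
Variables (A : algType R) (e : I -> A) (be : is_basis e).

(* The S-algebra A (x)_R S, for A free over R with basis e and S an R-algebra
   via phi: x stands for \sum_i e i (x) x i, and the structure constants are
   the images of those of A. *)
Definition scalar_ext of {rmorphism R -> S} & is_basis e : Type :=
  {ffun I -> S^o}.
Local Notation AS := (scalar_ext phi be).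

HB.instance Definition _ := GRing.Lmodule.on AS.

Definition ext_in (a : A) : AS := [ffun i => phi (coord be a i)].

Definition ext_mul (x y : AS) : AS :=
  \sum_i \sum_j (x i * y j) *: ext_in (e i * e j).

Lemma ext_inD a b : ext_in (a + b) = ext_in a + ext_in b.
Proof. by apply/ffunP => i; rewrite !ffunE coordD ffunE rmorphD. Qed.

Lemma ext_inZ k a : ext_in (k *: a) = phi k *: ext_in a.
Proof. by apply/ffunP => i; rewrite !ffunE coordZ rmorphM. Qed.

Lemma ext_in_sum (J : finType) (k : J -> R) (g : J -> A) :
  ext_in (\sum_j k j *: g j) = \sum_j phi (k j) *: ext_in (g j).
Proof.
have in0 : ext_in 0 = 0 by rewrite -(scale0r 0) ext_inZ rmorph0 scale0r.
rewrite (big_morph ext_in ext_inD in0).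
by apply: eq_bigr => j _; rewrite ext_inZ.
Qed.

Lemma ext_in_basis i : ext_in (e i) = [ffun j => (i == j)%:R].
Proof.
apply/ffunP => j; rewrite !ffunE.
rewrite (@coord_uniq _ _ be (e i) [ffun j => (i == j)%:R]).
  by rewrite ffunE rmorph_nat.
rewrite (bigD1 i) //= ffunE eqxx scale1r big1 ?addr0 // => k ki.
by rewrite ffunE eq_sym (negPf ki) scale0r.
Qed.

Lemma ext_sum (x : AS) : x = \sum_i x i *: ext_in (e i).
Proof.
apply/ffunP => j; rewrite sum_ffunE (bigD1 j) //= ext_in_basis !ffunE eqxx.
rewrite big1 ?addr0 => [|k kj]; first by rewrite -[_ *: _]/(_ * _) mulr1.
by rewrite ext_in_basis !ffunE (negPf kj) scaler0.
Qed.

Fact ext_mulDl : left_distributive ext_mul +%R.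
Proof.
move=> x y z; rewrite /ext_mul -big_split; apply: eq_bigr => i _ /=.
rewrite -big_split; apply: eq_bigr => j _ /=.
by rewrite ffunE mulrDl scalerDl.
Qed.

Fact ext_mulDr : right_distributive ext_mul +%R.
Proof.
move=> x y z; rewrite /ext_mul -big_split; apply: eq_bigr => i _ /=.
rewrite -big_split; apply: eq_bigr => j _ /=.
by rewrite ffunE mulrDr scalerDl.
Qed.

Fact ext_mulZl (k : S) (x y : AS) : k *: ext_mul x y = ext_mul (k *: x) y.
Proof.
rewrite /ext_mul scaler_sumr; apply: eq_bigr => i _; rewrite scaler_sumr.
by apply: eq_bigr => j _; rewrite scalerA ffunE mulrA.
Qed.

Fact ext_mulZr (k : S) (x y : AS) : k *: ext_mul x y = ext_mul x (k *: y).
Proof.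
rewrite /ext_mul scaler_sumr; apply: eq_bigr => i _; rewrite scaler_sumr.
by apply: eq_bigr => j _; rewrite scalerA ffunE mulrCA.
Qed.

Lemma ext_mul_suml (J : finType) (k : J -> S) (g : J -> AS) y :
  ext_mul (\sum_j k j *: g j) y = \sum_j k j *: ext_mul (g j) y.
Proof.
have m0 := esym (ext_mulZl 0 0 y); rewrite !scale0r in m0.
rewrite (big_morph (ext_mul^~ y) (fun u v => ext_mulDl u v y) m0).
by apply: eq_bigr => j _; rewrite ext_mulZl.
Qed.

Lemma ext_mul_sumr (J : finType) (k : J -> S) (g : J -> AS) x :
  ext_mul x (\sum_j k j *: g j) = \sum_j k j *: ext_mul x (g j).
Proof.
have m0 := esym (ext_mulZr 0 x 0); rewrite !scale0r in m0.
rewrite (big_morph (ext_mul x) (ext_mulDr x) m0).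
by apply: eq_bigr => j _; rewrite ext_mulZr.
Qed.

Lemma ext_mul_basis i j :
  ext_mul (ext_in (e i)) (ext_in (e j)) = ext_in (e i * e j).
Proof.
rewrite /ext_mul (bigD1 i) //= (bigD1 j) //= !ext_in_basis !ffunE !eqxx.
rewrite mulr1 scale1r big1 => [|k kj]; last first.
  by rewrite !ffunE eq_sym (negPf kj) mulr0 scale0r.
rewrite big1 ?addr0 // => k ki; rewrite big1 // => l _.
by rewrite !ffunE eq_sym (negPf ki) mul0r scale0r.
Qed.

Lemma ext_in_mul a b : ext_in (a * b) = ext_mul (ext_in a) (ext_in b).
Proof.
rewrite {2}(coordE be a) {2}(coordE be b) !ext_in_sum ext_mul_suml.
rewrite {1}(coordE be a) mulr_suml.
under eq_bigr => i _ do rewrite -scalerAl.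
rewrite ext_in_sum; apply: eq_bigr => i _; congr (_ *: _).
rewrite ext_mul_sumr {1}(coordE be b) mulr_sumr.
under eq_bigr => j _ do rewrite -scalerAr.
by rewrite ext_in_sum; apply: eq_bigr => j _; rewrite ext_mul_basis.
Qed.

Fact ext_mulA : associative ext_mul.
Proof.
move=> x y z; rewrite (ext_sum x) !ext_mul_suml; apply: eq_bigr => i _.
congr (_ *: _); rewrite (ext_sum y) ext_mul_suml !ext_mul_sumr ext_mul_suml.
apply: eq_bigr => j _; congr (_ *: _).
rewrite (ext_sum z) !ext_mul_sumr; apply: eq_bigr => k _; congr (_ *: _).
by rewrite -!ext_in_mul mulrA.
Qed.

Fact ext_mul1l : left_id (ext_in 1) ext_mul.
Proof.
move=> x; rewrite [in LHS](ext_sum x) ext_mul_sumr [in RHS](ext_sum x).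
by apply: eq_bigr => i _; rewrite -ext_in_mul mul1r.
Qed.

Fact ext_mul1r : right_id (ext_in 1) ext_mul.
Proof.
move=> x; rewrite [in LHS](ext_sum x) ext_mul_suml [in RHS](ext_sum x).
by apply: eq_bigr => i _; rewrite -ext_in_mul mulr1.
Qed.

Fact ext_1_neq0 : ext_in 1 != 0.
Proof.
have [i _ | I0] := pickP (@predT I); last first.
  by have := oner_neq0 A; rewrite (coordE be 1) big_pred0 ?eqxx.
apply: contraNneq (oner_neq0 S) => in1; apply/eqP.
have m0 := esym (ext_mulZl 0 0 (ext_in (e i))); rewrite !scale0r in m0.
have /ffunP/(_ i) : ext_in (e i) = 0 by rewrite -[LHS]ext_mul1l in1 m0.
by rewrite ext_in_basis !ffunE eqxx.
Qed.

HB.instance Definition _ := GRing.Zmodule_isNzRing.Build AS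
  ext_mulA ext_mul1l ext_mul1r ext_mulDl ext_mulDr ext_1_neq0.
HB.instance Definition _ := GRing.Lmodule_isLalgebra.Build S AS ext_mulZl.
HB.instance Definition _ := GRing.Lalgebra_isAlgebra.Build S AS ext_mulZr.

End ScalarExtension.

Definition ext_map (R S : comNzRingType) (phi : {rmorphism R -> S})
    (I J : finType) (A B : algType R) (e : I -> A) (e' : J -> B)
    (be : is_basis e) (be' : is_basis e') (f : A -> B)
    (x : scalar_ext phi be) : scalar_ext phi be' :=
  \sum_i x i *: ext_in phi be' (f (e i)).

Section FiniteDimensionalAlgebras.
Variables (K : fieldType) (B : algType K).

(* B is isomorphic to the product of the matrix algebras of size (n i).+1. *)
Definition split_semisimple : Prop :=
  exists (k : nat) (n : 'I_k -> nat)
         (f : forall i, {lrmorphism B -> 'M[K]_((n i).+1)}),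
    forall y : (forall i, 'M[K]_((n i).+1)), exists! x : B, forall i, f i x = y i.

Definition central_idempotent (e : B) : Prop :=
  e * e = e /\ forall x, e * x = x * e.

Definition minimal_central_idempotent (e : B) : Prop :=
  [/\ central_idempotent e, e <> 0 &
      forall e', central_idempotent e' -> e' * e = e' -> e' = 0 \/ e' = e].

End FiniteDimensionalAlgebras.

Definition in_span (R : comNzRingType) (V : lmodType R) (I : finType)
    (e : I -> V) (P : pred I) (v : V) : Prop :=
  exists x : I -> R, v = \sum_(i | P i) x i *: e i.

Definition cell_index (P : finType) (T : P -> finType) : finType :=
  {l : P & (T l * T l)%type}.

(* mu > la in the poset stands for mu strictly dominating la.  The coefficients
   cell_coef a t v = r(a; t, v) are those of an expansion in a basis modulo the
   higher span, hence unique as soon as cell_tab l is nonempty. *)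
Record cellular (R : comNzRingType) (A : algType R) := Cellular {
  cell_disp : Order.disp_t;
  cell_poset :> finPOrderType cell_disp;
  cell_tab : cell_poset -> finType;
  cell_star : {linear A -> A};
  cell_elt : forall l, cell_tab l -> cell_tab l -> A;
  cell_coef : forall l, A -> cell_tab l -> cell_tab l -> R;
  cell_basis (i : cell_index cell_tab) : A :=
    cell_elt (tagged i).1 (tagged i).2;
  cell_gt_span (l : cell_poset) : A -> Prop :=
    in_span cell_basis (fun i => l < tag i)%O;
  cell_ge_span (l : cell_poset) : A -> Prop :=
    in_span cell_basis (fun i => l <= tag i)%O;
  cell_starM : forall a b, cell_star (a * b) = cell_star b * cell_star a;
  cell_starK : involutive cell_star;
  cell_basisP : is_basis cell_basis;
  cell_eltM : forall l (t : cell_tab l) a (s : cell_tab l),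
    cell_gt_span l
      (cell_elt s t * a - \sum_v cell_coef a t v *: cell_elt s v);
  cell_elt_star : forall l (s t : cell_tab l),
    cell_gt_span l (cell_star (cell_elt s t) - cell_elt t s)
}.

Section CellModules.
Variables (R : comNzRingType) (A : algType R) (C : cellular A).

Definition cell_mod (l : C) : lmodType R := {ffun cell_tab l -> R^o}.

Definition cell_act (l : C) (v : cell_mod l) (a : A) : cell_mod l :=
  [ffun w => \sum_t v t * cell_coef a t w].

(* cell_mod l ^* (x) cell_mod l is the free module on pairs (s, t), standing
   for c_s^* (x) c_t. *)
Definition cell_tensor (l : C) (u v : cell_mod l) :
    {ffun cell_tab l * cell_tab l -> R^o} :=
  [ffun st => u st.1 * v st.2].

(* On cell_ge_span l, this is the bimodule isomorphism alpha_l precomposed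
   with the quotient by cell_gt_span l. *)
Definition cell_alpha (l : C) (x : A) :
    {ffun cell_tab l * cell_tab l -> R^o} :=
  [ffun st => coord (cell_basisP C) x
    (Tagged (fun mu : C => (cell_tab mu * cell_tab mu)%type) st)].

Definition cell_generator (l : C) (x : cell_mod l) : Prop :=
  forall v, exists a, v = cell_act x a.

(* Filtrations of a right A-module V with action act.  An isomorphism of
   M_{j+1} / M_j with a cell module is given as a surjective morphism from
   M_{j+1} with kernel M_j; its values outside M_{j+1} are irrelevant. *)
Record cell_filtration (V : lmodType R) (act : V -> A -> V) := CellFiltration {
  cf_len : nat;
  cf_sub : nat -> V -> Prop;
  cf_shape : 'I_cf_len -> C;
  cf_quo : forall j, V -> cell_mod (cf_shape j);
  cf_subD : forall j k u v, (j <= cf_len)%N ->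
    cf_sub j u -> cf_sub j v -> cf_sub j (k *: u + v);
  cf_sub_act : forall j v a, (j <= cf_len)%N ->
    cf_sub j v -> cf_sub j (act v a);
  cf_sub_bot : forall v, cf_sub 0%N v <-> v = 0;
  cf_sub_top : forall v, cf_sub cf_len v;
  cf_sub_incl : forall j v, (j < cf_len)%N -> cf_sub j v -> cf_sub j.+1 v;
  cf_quo_linear : forall (j : 'I_cf_len) k u v,
    cf_sub j.+1 u -> cf_sub j.+1 v ->
    cf_quo j (k *: u + v) = k *: cf_quo j u + cf_quo j v;
  cf_quo_act : forall (j : 'I_cf_len) v a,
    cf_sub j.+1 v -> cf_quo j (act v a) = cell_act (cf_quo j v) a;
  cf_quo_surj : forall (j : 'I_cf_len) w,
    exists2 v, cf_sub j.+1 v & cf_quo j v = w;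
  cf_quo_ker : forall (j : 'I_cf_len) v,
    cf_sub j.+1 v -> (cf_quo j v = 0 <-> cf_sub j v)
}.

Definition order_preserving (V : lmodType R) (act : V -> A -> V)
    (M : cell_filtration act) : Prop :=
  forall i j : 'I_(cf_len M), j = i.+1 :> nat ->
    (cf_shape (c := M) j < cf_shape (c := M) i)%O.

End CellModules.

Arguments cf_shape {R A C V act} c _.
Arguments cf_quo {R A C V act} c _ _.
Arguments cf_sub {R A C V act} c _ _.

Section CellularOverFractions.
Variables (R : idomainType) (A : algType R) (C : cellular A).
Local Notation F := {fraction R}.

Definition algF : algType F := scalar_ext (@tofrac R) (cell_basisP C).

Definition to_algF (a : A) : algF := ext_in (@tofrac R) (cell_basisP C) a.

Definition cell_modF (l : C) : lmodType F := {ffun cell_tab l -> F^o}.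

Definition to_cell_modF (l : C) (v : cell_mod l) : cell_modF l :=
  [ffun t => @tofrac R (v t)].

Definition cell_actF (l : C) (v : cell_modF l) (x : algF) : cell_modF l :=
  [ffun w => \sum_i \sum_t
     v t * ((x : {ffun _ -> F^o}) i * tofrac (cell_coef (cell_basis i) t w))].

(* A minimal central idempotent acts on a simple module as 0 or as 1. *)
Definition block_idempotent (l : C) (z : algF) : Prop :=
  minimal_central_idempotent z /\ exists v, cell_actF (l := l) v z <> 0.

End CellularOverFractions.

Record cellular_tower (R : idomainType) := CellularTower {
  tw_alg :> nat -> algType R;
  tw_cell : forall r, cellular (tw_alg r);
  tw_inc : forall s r, (s <= r)%N -> {lrmorphism tw_alg s -> tw_alg r};
  tw_inc_inj : forall s r (sr : (s <= r)%N), injective (tw_inc sr);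
  tw_inc_id : forall r (a : tw_alg r), tw_inc (leqnn r) a = a;
  tw_inc_comp : forall q s r (qs : (q <= s)%N) (sr : (s <= r)%N) a,
    tw_inc (leq_trans qs sr) a = tw_inc sr (tw_inc qs a);
  tw_inc_star : forall s r (sr : (s <= r)%N) a,
    tw_inc sr (cell_star (tw_cell s) a) = cell_star (tw_cell r) (tw_inc sr a)
}.

Section Towers.
Variables (R : idomainType) (A : cellular_tower R).

Definition Ahat (r : nat) := tw_cell A r.
Definition Delta (r : nat) (la : Ahat r) : lmodType R := cell_mod la.
Definition AF (r : nat) : algType {fraction R} := algF (tw_cell A r).

Definition tw_incF (s r : nat) (sr : (s <= r)%N) : AF s -> AF r :=
  ext_map (cell_basisP (tw_cell A r)) (tw_inc A sr).

Definition res_act (r : nat) (mu : Ahat r.+1) (v : Delta mu) (a : A r) :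
  Delta mu := cell_act v (tw_inc A (leqnSn r) a).

End Towers.

Record diagram_algebras (R : idomainType) (A : cellular_tower R) :=
DiagramAlgebras {
  dg_delta : forall r (la : Ahat A r), Delta la;
  dg_m : forall r, Ahat A r -> A r;
  dg_deltaP : forall r (la : Ahat A r), cell_generator (dg_delta la);
  dg_m_ge : forall r (la : Ahat A r), cell_ge_span la (dg_m la);
  dg_m_alpha : forall r (la : Ahat A r),
    cell_alpha la (dg_m la) = cell_tensor (dg_delta la) (dg_delta la);
  dg_A0 : bijective (fun k : R => k%:A : A 0%N);
  dg_vac : Ahat A 0;
  dg_vacP : forall la : Ahat A 0, la = dg_vac;
  dg_Delta0 : #|cell_tab dg_vac| = 1%N;
  dg_m0 : dg_m dg_vac = 1;
  dg_m_star : forall r (la : Ahat A r),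
    cell_star (tw_cell A r) (dg_m la) = dg_m la;
  dg_split : forall r, split_semisimple (AF A r);
  dg_filt : forall r (mu : Ahat A r.+1),
    cell_filtration (tw_cell A r) (@res_act R A r mu);
  dg_filt_order : forall r (mu : Ahat A r.+1), order_preserving (dg_filt mu);
  dg_edge (r : nat) (la : Ahat A r) (mu : Ahat A r.+1) : Prop :=
    exists j, cf_shape (dg_filt mu) j = la;
  (* The branching factors d_{la -> mu}; only edges la -> mu matter. *)
  dg_d : forall r, Ahat A r -> Ahat A r.+1 -> A r.+1;
  dg_d_sub : forall r (mu : Ahat A r.+1) (j : 'I_(cf_len (dg_filt mu))),
    cf_sub (dg_filt mu) j.+1
      (cell_act (dg_delta mu) (dg_d (cf_shape (dg_filt mu) j) mu));
  dg_d_quo : forall r (mu : Ahat A r.+1) (j : 'I_(cf_len (dg_filt mu))),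
    cf_quo (dg_filt mu) j
      (cell_act (dg_delta mu) (dg_d (cf_shape (dg_filt mu) j) mu))
    = dg_delta (cf_shape (dg_filt mu) j);
  dg_u : forall r (mu : Ahat A r) (la : Ahat A r.+1), dg_edge mu la ->
    exists u : A r.+1,
      dg_m la * dg_d mu la
      = cell_star (tw_cell A r.+1) u * tw_inc A (leqnSn r) (dg_m mu)
}.

Section Paths.
Variables (R : idomainType) (A : cellular_tower R) (D : diagram_algebras A).

Record Std (r : nat) (nu : Ahat A r) := Path {
  path_vertex :> forall s, (s <= r)%N -> Ahat A s;
  path_start : path_vertex (leq0n r) = dg_vac D;
  path_step : forall s (h : (s < r)%N),
    dg_edge D (path_vertex (ltnW h)) (path_vertex h);
  path_end : path_vertex (leqnn r) = nu
}.

Variables (r : nat) (nu : Ahat A r) (t : Std nu).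

(* The ordered product d_{t(r-1) -> t(r)} ... d_{t(0) -> t(1)} *)
Definition path_d : A r :=
  \prod_(i < r)
    let h := ltn_ord (rev_ord i) in
    tw_inc A h (dg_d D (t _ (ltnW h)) (t _ h)).

(* The coset m_nu d_t + A^{> nu}, under the identification of m_nu a + A^{> nu}
   with delta(nu) a. *)
Definition murphy : Delta nu := cell_act (dg_delta D nu) path_d.

Variable z : forall s, Ahat A s -> AF A s.

Definition path_F : AF A r :=
  \prod_(s < r) tw_incF (ltn_ord s) (z (t _ (ltn_ord s))).

Definition seminormal : cell_modF nu :=
  cell_actF (to_cell_modF murphy) path_F.

End Paths.

Section JucysMurphy.
Variables (R : idomainType) (A : cellular_tower R) (D : diagram_algebras A).
(* L 0 is a dummy value: the families are indexed by i >= 1. *)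
Variable L : forall i, A i.

Definition jm_symmetric : Prop :=
  forall r, cell_star (tw_cell A r.+1) (L r.+1) = L r.+1.

Definition jm_commutes : Prop :=
  forall r (a : A r),
    L r.+1 * tw_inc A (leqnSn r) a = tw_inc A (leqnSn r) a * L r.+1.

Definition additive_JM : Prop :=
  [/\ jm_symmetric, jm_commutes &
    exists d : forall r, Ahat A r -> R,
      (forall r (la : Ahat A r) (v : Delta la), (0 < r)%N ->
        cell_act v (\sum_(i < r) tw_inc A (ltn_ord i) (L i.+1)) = d r la *: v)
      /\ d 0%N (dg_vac D) = 0].

Definition multiplicative_JM : Prop :=
  [/\ forall r, exists M, L r.+1 * M = 1 /\ M * L r.+1 = 1,
      jm_symmetric, jm_commutes &
    exists d : forall r, Ahat A r -> R,
      (forall r (la : Ahat A r) (v : Delta la), (0 < r)%N ->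
        cell_act v (\prod_(i < r) tw_inc A (ltn_ord i) (L i.+1)) = d r la *: v)
      /\ d 0%N (dg_vac D) = 1].

End JucysMurphy.

(* Main.v *)
Require Import Defs.
From mathcomp Require Import all_boot all_order all_algebra.
Local Open Scope ring_scope.

Set Implicit Arguments.
Unset Strict Implicit.
Unset Printing Implicit Defensive.

Import Order.TTheory GRing.Theory.

(** Write S_j for the partial sum L_1 + ... + L_j, or the partial product
L_1 ... L_j in the multiplicative case.  It acts on the cell module of mu at
level j as the scalar d(mu).  If f_t is an eigenvector of each S_j, with
eigenvalue d(t(j)), then it is one of L_{i+1}, which is S_{i+1} - S_i, resp. the
quotient of S_{i+1} by S_i, with eigenvalue d(t(i+1)) - d(t(i)), resp.
d(t(i+1)) / d(t(i)).

Since f_t = m_t F_t, it is enough to prove F_t S_j = d(t(j)) F_t in the algebra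
of level r.  Two facts give it.

- Every L_i commutes with every factor z_s of F_t (path_factor_comm): if i > s
  because L_i centralises the algebra of level i - 1, which contains z_s; if
  i <= s because z_s is central in the algebra of level s, which contains L_i.
  So S_j can be moved next to the factor z_j.

- z_j S_j = d(t(j)) z_j (block_scalar).  The elements that kill the simple
  module of z_j form a two-sided ideal, to which S_j - d(t(j)) belongs.  A
  minimal central idempotent z of a split semisimple algebra cuts out a matrix
  algebra, so an ideal that contains some nonzero z x contains z itself
  (ideal_contains_block).  But z_j does not kill its simple module, hence
  z_j (S_j - d(t(j))) = 0.

The quotient d(t(i+1)) / d(t(i)) lies in R and not just in its fraction field:
a product of invertible elements that acts as a scalar on a nonzero free
R-module forces that scalar to be a unit (cell_scalar_unit).

The remaining lemmas verify that the scalar extensions behave as modules and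
algebras should: the cell modules are modules, over R and over the fractions,
and the inclusions of the tower extend to morphisms of algebras. *)

Local Notation coord := Defs.coord.

(** * Coordinates and scalar extension *)

Section Basis.
Variables (R : comNzRingType) (I : finType) (A : algType R).
Variables (e : I -> A) (be : is_basis e).

Lemma coord_sum (J : finType) (P : pred J) (k : J -> R) (g : J -> A) i :
  coord be (\sum_(j | P j) k j *: g j) i
  = \sum_(j | P j) k j * coord be (g j) i.
Proof.
apply: (big_ind2 (fun u x => coord be u i = x)) => [|u x v y <- <-|j _].
- by rewrite -(scale0r 0) coordZ mul0r.
- by rewrite coordD ffunE.
- exact: coordZ.
Qed.

Lemma coord_basis i j : coord be (e i) j = (i == j)%:R.
Proof.
rewrite (@coord_uniq _ _ _ _ be (e i) [ffun j => (i == j)%:R]) ?ffunE //.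
rewrite (bigD1 i) //= ffunE eqxx scale1r big1 ?addr0 // => k ki.
by rewrite ffunE eq_sym (negPf ki) scale0r.
Qed.

Lemma coord_in_span (P : pred I) v i :
  in_span e P v -> ~~ P i -> coord be v i = 0.
Proof.
move=> [x ->] Pi; rewrite coord_sum big1 // => j Pj.
rewrite coord_basis; case: eqP => [ji|_]; last by rewrite mulr0.
by rewrite -ji Pj in Pi.
Qed.

Variables (S : comNzRingType) (phi : {rmorphism R -> S}).

(** The elements coming from A span its scalar extension; this reduces an
identity that is linear in x to the case where it holds already in A. *)
Lemma scalar_ext_ind (P : scalar_ext phi be -> Prop) :
    (forall a, P (ext_in phi be a)) ->
    (forall k x y, P x -> P y -> P (k *: x + y)) ->
  forall x, P x.
Proof.
move=> Pin Plin x; rewrite (ext_sum x).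
have P0 : P 0.
  by rewrite -[0](addNr (ext_in phi be 1)) -scaleN1r; apply: Plin; apply: Pin.
apply: big_ind => // [u v Pu Pv|i _].
  by rewrite -[u]scale1r; apply: Plin.
by rewrite -[_ *: _]addr0; apply: Plin.
Qed.

Lemma ext_in_rmul a b :
  ext_in phi be (a * b)
  = ext_in phi be a * ext_in phi be b :> scalar_ext phi be.
Proof. exact: ext_in_mul. Qed.

End Basis.

Section ExtMap.
Variables (R S : comNzRingType) (phi : {rmorphism R -> S}).
Variables (I J : finType) (A B : algType R) (e : I -> A) (e' : J -> B).
Variables (be : is_basis e) (be' : is_basis e') (f : {lrmorphism A -> B}).
Local Notation fS := (@ext_map _ _ phi _ _ _ _ _ _ be be' f).

Lemma ext_map_in a : fS (ext_in phi be a) = ext_in phi be' (f a).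
Proof.
rewrite /ext_map [in RHS](coordE be a) linear_sum /=.
under [in RHS]eq_bigr => i _ do rewrite linearZ /=.
by rewrite ext_in_sum; apply: eq_bigr => i _; rewrite ffunE.
Qed.

Lemma ext_mapZ k x : fS (k *: x) = k *: fS x.
Proof.
by rewrite /ext_map scaler_sumr; apply: eq_bigr => i _; rewrite ffunE scalerA.
Qed.

Lemma ext_map_linear k x y : fS (k *: x + y) = k *: fS x + fS y.
Proof.
rewrite -ext_mapZ /ext_map -big_split; apply: eq_bigr => i _ /=.
by rewrite [in LHS]ffunE scalerDl.
Qed.

Lemma ext_mapM x y : fS (x * y) = fS x * fS y.
Proof.
elim/scalar_ext_ind: x => [a|k x x' IH IH']; last first.
  by rewrite mulrDl -scalerAl !ext_map_linear IH IH' mulrDl -scalerAl.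
elim/scalar_ext_ind: y => [b|k y y' IH IH']; last first.
  by rewrite mulrDr -scalerAr !ext_map_linear IH IH' mulrDr -scalerAr.
by rewrite -ext_in_rmul !ext_map_in rmorphM ext_in_rmul.
Qed.

End ExtMap.

(** * Ideals of split semisimple algebras *)

Section SemisimpleIdeals.
Variables (K : fieldType) (B : algType K).

(** As z is minimal, it lives in a single matrix factor, and a nonzero matrix
generates its whole matrix algebra as an ideal: sandwiching it between
elementary matrices moves a nonzero entry to each diagonal position. *)
Lemma ideal_contains_block (z x : B) (I : B -> Prop) :
    split_semisimple B -> minimal_central_idempotent z ->
    (forall u v, I u -> I v -> I (u + v)) ->
    (forall u v, I u -> I (v * u)) -> (forall u v, I u -> I (u * v)) ->
  z * x <> 0 -> I (z * x) -> I z.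
Proof.
move=> [k [n [f fP]]] [[zz zC] z0 zmin] ID IMl IMr zx0 Izx.
have fM j u v : f j (u * v) = f j u * f j v by rewrite rmorphM.
have finj u v : (forall i, f i u = f i v) -> u = v.
  move=> uv; have [w [_ wP]] := fP (fun i => f i v).
  by rewrite -(wP u) ?(wP v).
have [i fiz0] : exists i, f i z != 0.
  apply/existsP; apply: contraT => /existsPn fz0; case: z0; apply: finj => i.
  by rewrite raddf0; apply/eqP; move: (fz0 i); rewrite negbK.
(* The element with component M in the factor i and 0 in the others. *)
pose lift (M : 'M[K]_((n i).+1)) j : 'M[K]_((n j).+1) :=
  if eqVneq i j is EqNotNeq ij then ecast j 'M[K]_((n j).+1) ij M else 0.
have liftP M : exists u, f i u = M /\ forall j, j != i -> f j u = 0.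
  have [u [uP _]] := fP (lift M); exists u; split=> [|j ji]; rewrite uP /lift.
    by case: eqVneq => [ii|/eqP//]; rewrite (eq_irrelevance ii erefl).
  by case: eqVneq => // ij; rewrite ij eqxx in ji.
(* The unit c of the factor i is a central idempotent, and c z is a nonzero
   central idempotent below z, hence equal to z. *)
have [c [ci cj]] := liftP 1.
have cC u : c * u = u * c.
  apply: finj => j; rewrite !fM; have [->|ji] := eqVneq j i.
    by rewrite ci mul1r mulr1.
  by rewrite (cj _ ji) mul0r mulr0.
have cc : c * c = c.
  apply: finj => j; rewrite !fM; have [->|ji] := eqVneq j i.
    by rewrite ci mul1r.
  by rewrite (cj _ ji) mul0r.
have cz : c * z = z.
  have czC : central_idempotent (c * z).
    split=> [|u]; last by rewrite -mulrA (zC u) mulrA (cC u) mulrA.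
    by rewrite mulrA -(mulrA c z) zC mulrA cc -mulrA zz.
  have czz : c * z * z = c * z by rewrite -mulrA zz.
  have [/(congr1 (f i))|//] := zmin _ czC czz.
  by rewrite fM ci mul1r raddf0 => /eqP; rewrite (negPf fiz0).
have [a [b xab]] : exists a b, f i (z * x) a b != 0.
  case: (pickP (fun ab => f i (z * x) ab.1 ab.2 != 0)) => [[a b]|x0].
    by exists a, b.
  case: zx0; apply: finj => j; rewrite raddf0.
  have [->|ji] := eqVneq j i; last first.
    by rewrite -cz !fM (cj _ ji) !mul0r.
  by apply/matrixP => a b; rewrite mxE; apply/eqP/negbFE/(x0 (a, b)).
have I0 : I 0 by rewrite -(mul0r (z * x)); apply: IMl.
have Isum (J : finType) (g : J -> B) : (forall j, I (g j)) -> I (\sum_j g j).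
  by move=> Ig; apply: big_ind.
(* The elementary matrices E_{p a} and E_{b p} of the factor i. *)
have [l [lE l0]] : exists l : 'I_(n i).+1 -> B,
    (forall p, f i (l p) = delta_mx p a)
    /\ forall p j, j != i -> f j (l p) = 0.
  have [l lP] := fin_all_exists (fun p => liftP (delta_mx p a)).
  by exists l; split=> p; case: (lP p).
have [r rP] := fin_all_exists (fun p => liftP (delta_mx b p)).
have cE y : f i y a b != 0 -> c = (f i y a b)^-1 *: \sum_p l p * y * r p.
  move=> yab; apply: finj => j; rewrite linearZ rmorph_sum /=.
  have [->|ji] := eqVneq j i; last first.
    rewrite (cj _ ji) big1 ?scaler0 // => p _.
    by rewrite !fM (l0 _ _ ji) !mul0r.
  rewrite ci; apply/matrixP => p q; rewrite !mxE summxE (bigD1 p) //= big1.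
    rewrite addr0 !fM lE.
    have [-> _] := rP p; rewrite -!mulmxE.
    rewrite mxE (bigD1 b) //= big1 => [|v vb].
      rewrite mxE (bigD1 a) //= big1 => [|v va].
        rewrite !mxE !eqxx /= mul1r !addr0 mulrA mulVf // mul1r.
        by rewrite [q == p]eq_sym.
      by rewrite !mxE (negPf va) andbF mul0r.
    by rewrite [X in _ * X]mxE (negPf vb) mulr0.
  move=> s sp; rewrite !fM lE.
  rewrite -!mulmxE mxE big1 // => v _; rewrite mxE big1 ?mul0r // => w _.
  by rewrite mxE eq_sym (negPf sp) mul0r.
rewrite -cz; apply: (IMr); rewrite (cE _ xab) -mulr_algl; apply: (IMl).
by apply: (Isum _) => p; apply: IMr; apply: IMl.
Qed.

End SemisimpleIdeals.

(** * Cell modules *)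

Section CellModules.
Variables (R : comNzRingType) (A : algType R) (C : cellular A).
Local Notation ix s t :=
  (Tagged (fun mu : C => (cell_tab mu * cell_tab mu)%type) (s, t)).

Lemma cell_eltME (l : C) (s t : cell_tab l) a :
  exists2 x, cell_gt_span l x
    & cell_elt s t * a = \sum_v cell_coef a t v *: cell_elt s v + x.
Proof.
exists (cell_elt s t * a - \sum_v cell_coef a t v *: cell_elt s v).
  exact: cell_eltM.
by rewrite addrC subrK.
Qed.

Lemma coord_cell_elt (l : C) (s t : cell_tab l) (v w : cell_tab l) :
  coord (cell_basisP C) (cell_elt s t) (ix v w)
  = ((s == v) && (t == w))%:R.
Proof.
have := coord_basis (cell_basisP C) (ix s t) (ix v w).
by rewrite eq_Tagged.
Qed.

Lemma coord_gt_span (l mu : C) x (v w : cell_tab l) :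
    (l <= mu)%O -> cell_gt_span mu x ->
  coord (cell_basisP C) x (ix v w) = 0.
Proof.
move=> lmu xmu; apply: (coord_in_span _ xmu).
by rewrite /= le_gtF.
Qed.

(** An intrinsic formula for r(a; t, v): any choice of the left index s gives
the same value.  It makes r linear in a, and multiplicative. *)
Lemma cell_coefE (l : C) (s t v : cell_tab l) a :
  cell_coef a t v = coord (cell_basisP C) (cell_elt s t * a) (ix s v).
Proof.
have [x xl ->] := cell_eltME s t a.
rewrite coordD ffunE coord_sum (coord_gt_span _ _ (lexx l) xl) addr0.
rewrite (bigD1 v) //= coord_cell_elt !eqxx mulr1 big1 ?addr0 // => w wv.
by rewrite coord_cell_elt (negPf wv) andbF mulr0.
Qed.

(** The span of the cells above l is a right ideal, so multiplying one of its
elements on the right creates no coordinate in the cell l. *)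
Lemma coord_gt_spanM (l : C) x b (v w : cell_tab l) :
    cell_gt_span l x ->
  coord (cell_basisP C) (x * b) (ix v w) = 0.
Proof.
move=> [c ->]; rewrite mulr_suml.
under eq_bigr => i _ do rewrite -scalerAl.
rewrite coord_sum big1 // => -[mu [s t]] /= lmu.
have [x' xmu ->] := cell_eltME s t b.
rewrite coordD ffunE (coord_gt_span _ _ (ltW lmu) xmu) addr0 coord_sum.
rewrite big1 ?mulr0 // => u _.
have := coord_basis (cell_basisP C) (ix s u) (ix v w).
rewrite /cell_basis /= => ->; case: eqP => [/(congr1 tag) /= E|_].
  by rewrite E ltxx in lmu.
by rewrite mulr0.
Qed.

(** The matrices (r(a; t, v)) are a representation, that is, the cell module is
a right module. *)
Lemma cell_coefM (l : C) (t w : cell_tab l) a b :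
  cell_coef (a * b) t w = \sum_v cell_coef a t v * cell_coef b v w.
Proof.
rewrite (cell_coefE t) mulrA; have [x xl ->] := cell_eltME t t a.
rewrite mulrDl coordD ffunE (coord_gt_spanM _ _ _ xl) addr0 mulr_suml.
under eq_bigr => v _ do rewrite -scalerAl.
rewrite coord_sum; apply: eq_bigr => v _.
by rewrite [cell_coef b v w](cell_coefE t).
Qed.

Lemma cell_coef_sum (l : C) (t w : cell_tab l) (J : finType) (k : J -> R)
    (g : J -> A) :
  cell_coef (\sum_j k j *: g j) t w = \sum_j k j * cell_coef (g j) t w.
Proof.
rewrite (cell_coefE t) mulr_sumr.
under eq_bigr => v _ do rewrite -scalerAr.
by rewrite coord_sum; apply: eq_bigr => v _; rewrite (cell_coefE t).
Qed.

Lemma cell_coef1 (l : C) (t w : cell_tab l) : cell_coef 1 t w = (t == w)%:R.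
Proof. by rewrite (cell_coefE t) mulr1 coord_cell_elt eqxx. Qed.

Lemma cell_coef_scalar (l : C) a d :
    (forall v : cell_mod l, cell_act v a = d *: v) ->
  forall t w : cell_tab l, cell_coef a t w = d * (t == w)%:R.
Proof.
move=> ad t w; have /ffunP/(_ w) := ad [ffun u => (t == u)%:R].
rewrite !ffunE (bigD1 t) //= ffunE eqxx mul1r big1 ?addr0 // => u ut.
by rewrite ffunE eq_sym (negPf ut) mul0r.
Qed.

(** Read on the diagonal entry at t, the matrix identity r(a) r(b) = 1 says that
d divides 1. *)
Lemma cell_scalar_unit (l : C) (t : cell_tab l) a b d :
    (forall v : cell_mod l, cell_act v a = d *: v) -> a * b = 1 ->
  exists d', d * d' = 1.
Proof.
move=> ad ab; exists (cell_coef b t t).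
have -> : 1 = \sum_v cell_coef a t v * cell_coef b v t.
  by rewrite -cell_coefM ab cell_coef1 eqxx.
rewrite (bigD1 t) //= big1 => [|v vt].
  by rewrite (cell_coef_scalar ad) eqxx mulr1 addr0.
by rewrite (cell_coef_scalar ad) eq_sym (negPf vt) mulr0 mul0r.
Qed.

End CellModules.

(** * Cell modules over the field of fractions *)

Section AlgebraLinearity.
Variables (K : pzRingType) (B : algType K).

Lemma mul_linl (k : K) (x y u : B) : (k *: x + y) * u = k *: (x * u) + y * u.
Proof. by rewrite mulrDl scalerAl. Qed.

Lemma mul_linr (k : K) (x y u : B) : u * (k *: x + y) = k *: (u * x) + u * y.
Proof. by rewrite mulrDr scalerAr. Qed.

End AlgebraLinearity.

Section CellularOverFractions.
Variables (R : idomainType) (A : algType R) (C : cellular A).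
Local Notation F := {fraction R}.

Lemma to_algF1 : to_algF C 1 = 1.
Proof. by []. Qed.

Lemma to_algFD a b : to_algF C (a + b) = to_algF C a + to_algF C b.
Proof. exact: ext_inD. Qed.

Lemma to_algFM a b : to_algF C (a * b) = to_algF C a * to_algF C b.
Proof. exact: ext_in_mul. Qed.

Lemma to_algFZ k a : to_algF C (k *: a) = tofrac k *: to_algF C a.
Proof. exact: ext_inZ. Qed.

Lemma algF_ind (P : algF C -> Prop) :
    (forall a, P (to_algF C a)) ->
    (forall k (x y : algF C), P x -> P y -> P (k *: x + y)) ->
  forall x, P x.
Proof. exact: scalar_ext_ind. Qed.

Variable l : C.
Implicit Types (v : cell_modF l) (x y : algF C).

Lemma cell_actF_in v a w :
  cell_actF v (to_algF C a) w = \sum_t v t * tofrac (cell_coef a t w).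
Proof.
rewrite ffunE exchange_big; apply: eq_bigr => t _ /=.
rewrite [a in RHS](coordE (cell_basisP C)) cell_coef_sum rmorph_sum mulr_sumr.
by apply: eq_bigr => i _; rewrite ffunE rmorphM mulrA.
Qed.

Lemma cell_modFE k u v w : (k *: u + v) w = k * u w + v w.
Proof. by rewrite !ffunE. Qed.

Lemma cell_actFE v x w :
  cell_actF v x w = \sum_i \sum_t
    v t * ((x : {ffun _ -> F^o}) i * tofrac (cell_coef (cell_basis i) t w)).
Proof. by rewrite ffunE. Qed.

Lemma cell_actF_linearl k u v x :
  cell_actF (k *: u + v) x = k *: cell_actF u x + cell_actF v x.
Proof.
apply/ffunP => w; rewrite cell_modFE !cell_actFE mulr_sumr -big_split.
apply: eq_bigr => i _; rewrite mulr_sumr -big_split; apply: eq_bigr => t _ /=.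
by rewrite cell_modFE mulrDl -mulrA.
Qed.

Lemma cell_actF_linearr k v x y :
  cell_actF v (k *: x + y) = k *: cell_actF v x + cell_actF v y.
Proof.
apply/ffunP => w; rewrite cell_modFE !cell_actFE mulr_sumr -big_split.
apply: eq_bigr => i _; rewrite mulr_sumr -big_split; apply: eq_bigr => t _ /=.
have -> : (k *: x + y : {ffun _ -> F^o}) i
    = k * (x : {ffun _ -> F^o}) i + (y : {ffun _ -> F^o}) i :> F.
  by rewrite !ffunE.
by rewrite mulrDl mulrDr -mulrA (mulrCA _ k).
Qed.

Lemma cell_actF0 x : cell_actF (0 : cell_modF l) x = 0.
Proof.
have := cell_actF_linearl (-1) 0 0 x.
by rewrite scaler0 addr0 scaleN1r addNr.
Qed.

Lemma cell_actFZ k v x : cell_actF v (k *: x) = k *: cell_actF v x.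
Proof.
have := cell_actF_linearr (-1) v x x; rewrite !scaleN1r !addNr => v0.
by have := cell_actF_linearr k v x 0; rewrite v0 !addr0.
Qed.

Lemma cell_actFD v x y : cell_actF v (x + y) = cell_actF v x + cell_actF v y.
Proof. by have := cell_actF_linearr 1 v x y; rewrite !scale1r. Qed.

(** Both sides are linear in x and in y, and on A this is the identity of
structure constants cell_coefM. *)
Lemma cell_actFM v x y : cell_actF v (x * y) = cell_actF (cell_actF v x) y.
Proof.
elim/algF_ind: x v => [a|k x x' IH IH'] v; last first.
  rewrite [cell_actF v (k *: x + x')]cell_actF_linearr cell_actF_linearl.
  rewrite -IH -IH' mul_linl.
  exact: cell_actF_linearr.
elim/algF_ind: y => [b|k y y' IH IH']; last first.
  rewrite [RHS]cell_actF_linearr -IH -IH' mul_linr.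
  exact: cell_actF_linearr.
rewrite -to_algFM; apply/ffunP => w.
rewrite !cell_actF_in.
under [RHS]eq_bigr => t _ do rewrite cell_actF_in mulr_suml.
rewrite exchange_big; apply: eq_bigr => t _ /=.
rewrite cell_coefM rmorph_sum mulr_sumr; apply: eq_bigr => u _.
by rewrite rmorphM mulrA.
Qed.

Lemma cell_actF_scalar a d :
    (forall v : cell_mod l, cell_act v a = d *: v) ->
  forall v, cell_actF v (to_algF C a) = tofrac d *: v.
Proof.
move=> ad v; apply/ffunP => w; rewrite cell_actF_in ffunE.
rewrite (bigD1 w) //= (cell_coef_scalar ad) eqxx mulr1 big1 => [|t tw].
  by rewrite addr0 mulrC.
by rewrite (cell_coef_scalar ad) (negPf tw) mulr0 rmorph0 mulr0.
Qed.

(** The simple module of a block is nonzero, since its idempotent acts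
nontrivially on it. *)
Lemma block_cell_tab_inhabited z : block_idempotent l z -> cell_tab l.
Proof.
move=> [_ vz]; have [t _|tab0] := pickP (@predT (cell_tab l)); first exact: t.
by case: notF; case: vz => v []; apply/ffunP => w; have := tab0 w.
Qed.

(** The annihilator of the simple module is an ideal that does not contain z, so
it meets the block of z in 0; and it contains a - d. *)
Lemma block_scalar z a d :
    split_semisimple (algF C) -> block_idempotent l z ->
    (forall v : cell_mod l, cell_act v a = d *: v) ->
  z * to_algF C a = tofrac d *: z.
Proof.
move=> ss [zmin [v0 v0z]] ad.
have actz v : cell_actF v (to_algF C a - (tofrac d)%:A) = 0.
  rewrite -scaleNr addrC cell_actF_linearr (cell_actF_scalar ad).
  rewrite -to_algF1 (@cell_actF_scalar 1 1).
    by rewrite rmorph1 scale1r scaleNr addNr.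
  move=> u.
  apply/ffunP => w; rewrite !ffunE (bigD1 w) //= cell_coef1 eqxx mulr1.
  rewrite big1 ?addr0 ?[RHS]mul1r // => t tw.
  by rewrite cell_coef1 (negPf tw) mulr0.
apply/eqP; rewrite -subr_eq0 -mulr_algr -mulrBr; apply: contraT => /eqP zx0.
case: v0z; move: v0.
apply: (ideal_contains_block (I := fun x => forall v, cell_actF v x = 0)
  ss zmin _ _ _ zx0).
- by move=> x y x0 y0 v; rewrite cell_actFD x0 y0 addr0.
- by move=> x y x0 v; rewrite cell_actFM x0.
- by move=> x y x0 v; rewrite cell_actFM x0 cell_actF0.
- by move=> v; rewrite cell_actFM actz.
Qed.

End CellularOverFractions.

(** * Jucys-Murphy elements and path idempotents *)

Lemma prod_eigen (K : pzRingType) (B : algType K) (I : eqType) (s : seq I)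
    (x : I -> B) (y : B) (k : K) (j : I) :
    (forall i, GRing.comm (x i) y) -> j \in s -> x j * y = k *: x j ->
  (\prod_(i <- s) x i) * y = k *: \prod_(i <- s) x i.
Proof.
move=> xy + xjy; elim: s => [//|i s IH].
rewrite inE big_cons => /predU1P[<-|js].
  have yC : GRing.comm y (\prod_(i <- s) x i).
    by apply: commr_prod => i' _; apply/commr_sym/xy.
  by rewrite -mulrA -yC mulrA xjy -scalerAl.
by rewrite -mulrA IH // scalerAr.
Qed.

Lemma comm_linear (K : pzRingType) (B : algType K) (k : K) (x y u : B) :
  GRing.comm x u -> GRing.comm y u -> GRing.comm (k *: x + y) u.
Proof. by move=> xu yu; rewrite /GRing.comm mul_linl mul_linr xu yu. Qed.

Section Tower.
Variables (R : idomainType) (A : cellular_tower R).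
Local Notation toF := (to_algF (tw_cell A _)).

Lemma tw_inc_irr s r (h h' : (s <= r)%N) a : tw_inc A h a = tw_inc A h' a.
Proof. by rewrite (bool_irrelevance h h'). Qed.

Lemma tw_inc_trans q s r (qs : (q <= s)%N) (sr : (s <= r)%N)
    (qr : (q <= r)%N) a :
  tw_inc A sr (tw_inc A qs a) = tw_inc A qr a.
Proof. by rewrite -tw_inc_comp; apply: tw_inc_irr. Qed.

Lemma tw_incD s r (h : (s <= r)%N) (a b : A s) :
  tw_inc A h (a + b) = tw_inc A h a + tw_inc A h b.
Proof. exact: linearD. Qed.

Lemma tw_incM s r (h : (s <= r)%N) (a b : A s) :
  tw_inc A h (a * b) = tw_inc A h a * tw_inc A h b.
Proof. exact: rmorphM. Qed.

Lemma tw_incF_in s r (h : (s <= r)%N) (a : A s) :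
  tw_incF h (toF a) = toF (tw_inc A h a).
Proof. exact: ext_map_in. Qed.

Lemma tw_incFM s r (h : (s <= r)%N) (x y : AF A s) :
  tw_incF h (x * y) = tw_incF h x * tw_incF h y.
Proof. exact: ext_mapM. Qed.

Lemma tw_incF_linear s r (h : (s <= r)%N) k (x y : AF A s) :
  tw_incF h (k *: x + y) = k *: tw_incF h x + tw_incF h y.
Proof. exact: ext_map_linear. Qed.

Lemma tw_incFZ s r (h : (s <= r)%N) k (x : AF A s) :
  tw_incF h (k *: x) = k *: tw_incF h x.
Proof. exact: ext_mapZ. Qed.

Variable L : forall i, A i.
Hypothesis LC : jm_commutes L.

Lemma jm_comm_lower i r (hi : (i < r)%N) s (hs : (s <= r)%N) (si : (s <= i)%N)
    (x : AF A s) :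
  GRing.comm (tw_incF hs x) (toF (tw_inc A hi (L i.+1))).
Proof.
elim/algF_ind: x => [a|k x y IHx IHy]; last first.
  by rewrite [tw_incF _ _]tw_incF_linear; apply: comm_linear.
rewrite tw_incF_in /GRing.comm -!to_algFM.
rewrite -(tw_inc_trans si (ltnW hi)) -(tw_inc_trans (leqnSn i) hi).
by rewrite -!tw_incM LC.
Qed.

(** If i < s, then L_{i+1} belongs to the algebra of level s, hence the
requirement that x be central; lower levels are centralised by L_{i+1}. *)
Lemma jm_comm_central i r (hi : (i < r)%N) s (hs : (s <= r)%N) (x : AF A s) :
    ((i < s)%N -> forall y, x * y = y * x) ->
  GRing.comm (tw_incF hs x) (toF (tw_inc A hi (L i.+1))).
Proof.
have [si _|is_ /(_ isT) xC] := leqP s i; first exact: jm_comm_lower.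
rewrite -(tw_inc_trans is_ hs) -[X in GRing.comm _ X]tw_incF_in.
apply: etrans (esym (tw_incFM _ _ _)) _.
exact: etrans (congr1 _ (xC _)) (tw_incFM _ _ _).
Qed.

Section Path.
Variables (D : diagram_algebras A) (z : forall s, Ahat A s -> AF A s).
Hypothesis hz : forall s (la : Ahat A s), block_idempotent la (z la).
Variables (r : nat) (la : Ahat A r) (t : Std D la).
Local Notation Ft := (path_F t z).

Lemma path_factor_comm (s : 'I_r) i (hi : (i < r)%N) :
  GRing.comm (tw_incF (ltn_ord s) (z (t _ (ltn_ord s))))
             (toF (tw_inc A hi (L i.+1))).
Proof.
apply: jm_comm_central => _ y.
by have [[[_ zC] _ _] _] := hz (t _ (ltn_ord s)); apply: zC.
Qed.

(** S is meant to be the partial sum or product S_{j+1}: it can be moved to the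
factor of F_t at level j+1, which turns it into the scalar d. *)
Lemma path_F_scalar j (hj : (j.+1 <= r)%N) (S : A j.+1) d :
    (forall s : 'I_r, GRing.comm (tw_incF (ltn_ord s) (z (t _ (ltn_ord s))))
             (toF (tw_inc A hj S))) ->
    (forall v : Delta (t _ hj), cell_act v S = d *: v) ->
  Ft * toF (tw_inc A hj S) = tofrac d *: Ft.
Proof.
move=> SC Sd; apply: (prod_eigen SC (mem_index_enum (Ordinal hj))) => /=.
rewrite (bool_irrelevance (ltn_ord (Ordinal hj)) hj).
rewrite -[toF (tw_inc A hj S)]tw_incF_in.
apply: etrans (esym (tw_incFM _ _ _)) _.
apply: etrans (congr1 _ (block_scalar (dg_split D _) (hz _) Sd)) _.
exact: tw_incFZ.
Qed.

(** The treatment common to sums and products: S is a sequence of elements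
built from the L_i, so that it commutes with whatever the L_i commute with.  At
level 0 no factor of F_t is available, hence the condition on S_0. *)
Lemma path_F_jm (S : forall j, A j) (d : forall j, Ahat A j -> R) :
    S 0%N = (d 0%N (dg_vac D))%:A ->
    (forall j (mu : Ahat A j) (v : Delta mu), (0 < j)%N ->
      cell_act v (S j) = d j mu *: v) ->
    (forall x : AF A r,
      (forall i (hi : (i < r)%N), GRing.comm x (toF (tw_inc A hi (L i.+1)))) ->
      forall j (hj : (j <= r)%N), GRing.comm x (toF (tw_inc A hj (S j)))) ->
  forall j (hj : (j <= r)%N),
    Ft * toF (tw_inc A hj (S j)) = tofrac (d j (t j hj)) *: Ft.
Proof.
move=> S0 Sd SC [|j] hj; last first.
  apply: path_F_scalar => [s|v]; last exact: Sd.
  by apply: SC => i hi; apply: path_factor_comm.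
rewrite S0 (dg_vacP D (t 0 hj)) linearZ rmorph1 to_algFZ to_algF1.
by rewrite -scalerAr mulr1.
Qed.

Lemma seminormal_eigen (y : AF A r) k :
  Ft * y = k *: Ft -> cell_actF (seminormal t z) y = k *: seminormal t z.
Proof. by move=> Fy; rewrite /seminormal -cell_actFM Fy cell_actFZ. Qed.

End Path.

Lemma comm_jm_sum r (x : AF A r) :
    (forall i (hi : (i < r)%N), GRing.comm x (toF (tw_inc A hi (L i.+1)))) ->
  forall j (hj : (j <= r)%N), GRing.comm x
    (toF (tw_inc A hj (\sum_(i < j) tw_inc A (ltn_ord i) (L i.+1)))).
Proof.
move=> xL j hj.
apply: (big_ind (fun a => GRing.comm x (toF (tw_inc A hj a)))) => [|a b|i _].
- rewrite -(scale0r 0) linearZ to_algFZ rmorph0 scale0r; exact: commr0.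
- by rewrite tw_incD to_algFD; apply: commrD.
- by rewrite (tw_inc_trans _ _ (leq_trans (ltn_ord i) hj)).
Qed.

Lemma comm_jm_prod r (x : AF A r) :
    (forall i (hi : (i < r)%N), GRing.comm x (toF (tw_inc A hi (L i.+1)))) ->
  forall j (hj : (j <= r)%N), GRing.comm x
    (toF (tw_inc A hj (\prod_(i < j) tw_inc A (ltn_ord i) (L i.+1)))).
Proof.
move=> xL j hj.
apply: (big_ind (fun a => GRing.comm x (toF (tw_inc A hj a)))) => [|a b|i _].
- rewrite rmorph1; exact: commr1.
- by rewrite tw_incM to_algFM; apply: commrM.
- by rewrite (tw_inc_trans _ _ (leq_trans (ltn_ord i) hj)).
Qed.

Lemma jm_sumS j :
  \sum_(i < j.+1) tw_inc A (ltn_ord i) (L i.+1)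
  = tw_inc A (leqnSn j) (\sum_(i < j) tw_inc A (ltn_ord i) (L i.+1)) + L j.+1.
Proof.
rewrite big_ord_recr linear_sum /=; congr (_ + _).
  apply: eq_bigr => i _.
  by rewrite (tw_inc_trans _ _ (ltn_ord (widen_ord (leqnSn j) i))).
by rewrite (tw_inc_irr _ (leqnn _)) tw_inc_id.
Qed.

Lemma jm_prodS j :
  \prod_(i < j.+1) tw_inc A (ltn_ord i) (L i.+1)
  = tw_inc A (leqnSn j) (\prod_(i < j) tw_inc A (ltn_ord i) (L i.+1)) * L j.+1.
Proof.
rewrite big_ord_recr rmorph_prod /=; congr (_ * _).
  apply: eq_bigr => i _.
  by rewrite (tw_inc_trans _ _ (ltn_ord (widen_ord (leqnSn j) i))).
by rewrite (tw_inc_irr _ (leqnn _)) tw_inc_id.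
Qed.

Lemma jm_prod_invertible :
    (forall j, exists M, L j.+1 * M = 1 /\ M * L j.+1 = 1) ->
  forall j, exists N, (\prod_(i < j) tw_inc A (ltn_ord i) (L i.+1)) * N = 1.
Proof.
move=> Linv; elim=> [|j [N SN]]; first by exists 1; rewrite big_ord0 mul1r.
have [M [LM _]] := Linv j; exists (M * tw_inc A (leqnSn j) N).
by rewrite jm_prodS mulrA -(mulrA _ (L j.+1)) LM mulr1 -tw_incM SN rmorph1.
Qed.

End Tower.

Theorem proposition4p5 (R : idomainType) (A : cellular_tower R)
    (D : diagram_algebras A)
    (z : forall s, Ahat A s -> AF A s)
    (hz : forall s (la : Ahat A s), block_idempotent la (z s la))
    (L : forall i, A i)
    (hL : additive_JM D L \/ multiplicative_JM D L) :
  exists kappa : forall r, Ahat A r -> Ahat A r.+1 -> R,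
  forall r (la : Ahat A r) (t : Std D la) i (hi : (i < r)%N),
    cell_actF (seminormal t z) (to_algF (tw_cell A r) (tw_inc A hi (L i.+1)))
    = tofrac (kappa i (t i (ltnW hi)) (t i.+1 hi)) *: seminormal t z.
Proof.
case: hL => [[_ LC [d [Sd d0]]]|[Linv _ LC [d [Pd d0]]]].
  (* L_{i+1} = S_{i+1} - S_i *)
  exists (fun i la mu => d i.+1 mu - d i la) => r la t i hi.
  apply: seminormal_eigen.
  have S0 : \sum_(i < 0) tw_inc A (ltn_ord i) (L i.+1) = (d 0%N (dg_vac D))%:A.
    by rewrite big_ord0 d0 scale0r.
  have FS := path_F_jm LC hz t S0 Sd (@comm_jm_sum _ _ L r).
  have := FS i.+1 hi.
  rewrite jm_sumS tw_incD (tw_inc_trans _ _ (ltnW hi)) to_algFD.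
  rewrite mulrDr FS rmorphB scalerBl => <-.
  by rewrite addrC addKr.
exists (fun i la mu => d i.+1 mu / d i la) => r la t i hi.
apply: seminormal_eigen.
have P0 : \prod_(i < 0) tw_inc A (ltn_ord i) (L i.+1) = (d 0%N (dg_vac D))%:A.
  by rewrite big_ord0 d0 scale1r.
have FP := path_F_jm LC hz t P0 Pd (@comm_jm_prod _ _ L r).
(* This makes the quotient defining kappa a true one. *)
have dU j (mu : Ahat A j) : d j mu \is a GRing.unit.
  case: j mu => [|j] mu; first by rewrite (dg_vacP D mu) d0 unitr1.
  have [N PN] := jm_prod_invertible Linv j.+1.
  have [d' dd'] := cell_scalar_unit (block_cell_tab_inhabited (hz _ mu))
    (fun v => Pd _ mu v isT) PN.
  by apply/unitrP; exists d'; rewrite mulrC dd'.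
have := FP i.+1 hi.
rewrite jm_prodS tw_incM (tw_inc_trans _ _ (ltnW hi)) to_algFM.
rewrite mulrA FP -scalerAl => dFL.
have dF0 : tofrac (d i (t i (ltnW hi))) != 0.
  rewrite tofrac_eq0; apply/eqP => dla0.
  by have := dU i (t i (ltnW hi)); rewrite dla0 unitr0.
have dK : tofrac (d i.+1 (t i.+1 hi)) = tofrac (d i (t i (ltnW hi)))
    * tofrac (d i.+1 (t i.+1 hi) / d i (t i (ltnW hi))).
  by rewrite -rmorphM mulrC divrK.
apply: (scalerI dF0); apply: etrans dFL _.
exact: etrans (congr1 ( *:%R^~ _) dK) (esym (scalerA _ _ _)).
Qed.
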